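(* Let $D,F$ be finite digraphs. The following are equivalent. (i) $U_D(h)\ge U_F(h)$ for all standard probability spaces $(\Omega,\mathcal F,\mu)$ and all kernels $h:\Omega^2\to[0,1]$. (ii) $t(D,H)\ge t(F,H)$ for all finite digraphs $H$.
   Context: A digraph is a finite directed simple loopless graph: at most one arc for each ordered pair of distinct vertices (opposite arcs are allowed). A kernel on a probability space $(\Omega,\mathcal F,\mu)$ is a measurable function $h:\Omega^2\to[0,1]$ (not necessarily symmetric). For a finite digraph $D$ with vertex set $\{v_1,\dots,v_n\}$ and arc set $E(D)$, $$U_D(h):=\int_{\Omega^n}\prod_{(v_i,v_j)\in E(D)}h(x_i,x_j)\,d\mu(x_1)\cdots d\mu(x_n).$$ For finite digraphs $D,H$, $t(D,H):=\hom(D,H)/|V(H)|^{|V(D)|}$, where $\hom(D,H)$ is the number of digraph homomorphisms $D\to H$ (maps $V(D)\to V(H)$ sending arcs to arcs, preserving direction). *)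

(* Defs.v *)
From HB Require Import structures.
From mathcomp Require Import all_boot all_order all_algebra.
From mathcomp Require Import all_classical all_reals all_analysis.

Set Implicit Arguments.
Unset Strict Implicit.
Unset Printing Implicit Defensive.

Import Order.TTheory GRing.Theory Num.Theory.
Import numFieldNormedType.Exports.

Local Open Scope classical_set_scope.
Local Open Scope ring_scope.

Record digraph := Digraph {
  vertex :> finType;
  arc : rel vertex;
  arc_irrefl : irreflexive arc }.

Definition is_hom (D H : digraph) (f : D -> H) : bool :=
  [forall u, forall v, arc u v ==> arc (f u) (f v)].

Definition hom (D H : digraph) : nat := #|[set f : {ffun D -> H} | is_hom f]|.

(* Meaningful only when H has at least one vertex. *)
Definition hom_density (D H : digraph) : rat :=
  (hom D H)%:R / (#|H| ^ #|D|)%:R.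

(* On a Hausdorff space the pseudometric is a metric. *)
Definition polish (R : realType) (P : completePseudoMetricType R) : Prop :=
  hausdorff_space P /\ exists2 S : set P, countable S & dense S.

(* T is isomorphic, as a measurable space, to a Polish space with its Borel
   sigma-algebra.  A standard probability space is such a T together with a
   probability measure; the measure is not required to be complete. *)
Definition standard_borel (R : realType) (d : measure_display)
    (T : measurableType d) : Prop :=
  exists P : completePseudoMetricType R, polish P /\
    exists2 f : T -> P, bijective f &
      forall A : set T, measurable A <-> <<s @open P >> (f @` A).

Definition cons_tuple (d : measure_display) (T : measurableType d) (n : nat)
    (z : T * n.-tuple T) : n.+1.-tuple T :=
  [tuple of z.1 :: z.2].

Lemma measurable_cons_tuple (d : measure_display) (T : measurableType d)
    (n : nat) : measurable_fun setT (@cons_tuple d T n).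
Proof. exact: measurable_cons. Qed.

HB.instance Definition _ (d : measure_display) (T : measurableType d)
    (n : nat) :=
  isMeasurableFun.Build _ _ _ _ (@cons_tuple d T n)
    (@measurable_cons_tuple d T n).

(* The n-fold product of mu on n.-tuple T with its product sigma-algebra: the
   law of (x_1, ..., x_n) is the image of mu \x (law of (x_2, ..., x_n)). *)
Fixpoint power_measure (d : measure_display) (T : measurableType d)
    (R : realType) (mu : probability T R) (n : nat) :
    probability (n.-tuple T) R :=
  match n with
  | 0 => dirac [tuple]
  | m.+1 => distribution (mu \x power_measure mu m)%E (@cons_tuple d T m)
  end.

Definition kernel01 (d : measure_display) (T : measurableType d)
    (R : realType) (h : T * T -> R) : Prop :=
  measurable_fun setT h /\ forall z, 0 <= h z <= 1.

(* The vertices of D are numbered by enum_rank. *)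
Definition U (d : measure_display) (T : measurableType d) (R : realType)
    (mu : probability T R) (D : digraph) (h : T * T -> R) : \bar R :=
  (\int[power_measure mu #|D|]_x
    (\prod_(e : D * D | arc e.1 e.2)
       h (tnth x (enum_rank e.1), tnth x (enum_rank e.2)))%R%:E)%E.

(* Main.v *)
Require Import Defs.
From HB Require Import structures.
From mathcomp Require Import all_boot all_order all_algebra.
From mathcomp Require Import all_classical all_reals all_analysis.
From mathcomp Require Import measurable_realfun.
From mathcomp Require Import ring lra.

Set Implicit Arguments.
Unset Strict Implicit.
Unset Printing Implicit Defensive.

Import Order.TTheory GRing.Theory Num.Theory.
Import numFieldNormedType.Exports.

Local Open Scope classical_set_scope.
Local Open Scope ring_scope.

(** From kernels to digraphs: a finite digraph H with vertices embedded in the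
line by a carries the uniform measure on a(V(H)), and the 0/1 kernel h that is 1
exactly on the arcs of H satisfies U_D(h) = hom(D, H) / |H|^|D|
([U_arc_kernel]).  So the densities of homomorphisms are particular values of
the functionals U_D.

From digraphs to kernels: sample x_1, ..., x_N independently from mu, then draw
the arc (i, j), i <> j, with probability h(x_i, x_j), independently for all
ordered pairs.  The hypothesis holds for every outcome, hence for the
expectations.  An injective map V(D) -> {1, ..., N} is a homomorphism with
conditional probability the product of h(x_phi(u), x_phi(v)) over the arcs
(u, v) ([prob_is_hom]), whose integral is exactly U_D(h) ([integral_weight]).
The maps that are not injective contribute a number between 0 and their
proportion 1 - N(N-1)...(N-|D|+1) / N^|D|, which is at most |D|^2 / N
([ffact_ratio_ge]).  Letting N tend to infinity turns the inequality of
expected densities into U_F(h) <= U_D(h).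

The random digraph is never built as a random variable: for given edge
probabilities it is a finite weighted sum over arc sets, and only the inequality
that results from it is integrated over the sample points ([sum_weight_le],
[U_le_of_hom_density_le]).  Both directions identify a measure on tuples by its
values on boxes, which determine the product measure
([power_measure_unique]). *)

(** * Product measures are determined by boxes *)

Definition box (T : Type) (n : nat) (A : 'I_n -> set T) : set (n.-tuple T) :=
  [set x | forall i, A i (tnth x i)].

Lemma measurable_box d (T : measurableType d) n (A : 'I_n -> set T) :
  (forall i, measurable (A i)) -> measurable (box A).
Proof.
move=> mA.
have -> : box A = \bigcap_(i in [set: 'I_n]) ((fun x => tnth x i) @^-1` A i).
  by apply/seteqP; split=> x /= h i; [move=> _; exact: h|exact: (h i I)].
apply: fin_bigcap_measurable => [|i _]; first exact: finite_finset.
by rewrite -[X in measurable X]setTI; apply: measurable_tnth.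
Qed.

Lemma power_measure_box d (T : measurableType d) (R : realType)
    (mu : probability T R) n (A : 'I_n -> set T) :
  (forall i, measurable (A i)) ->
  power_measure mu n (box A) = (\prod_(i < n) mu (A i))%E.
Proof.
elim: n A => [|n IH] A mA.
  by rewrite big_ord0 /= diracE mem_set//= => -[].
rewrite big_ord_recl -(IH (fun i => A (lift ord0 i)))//.
rewrite -product_measure1E//; last exact: measurable_box.
rewrite /= /distribution /pushforward /=; congr (_ _).
apply/seteqP; split=> -[x t] /=.
  by move=> h; split=> [|i]; [exact: (h ord0)|have := h (lift ord0 i);
    rewrite tnthS].
case=> h0 h i; case: (unliftP ord0 i) => [j ->|->]; last by [].
by rewrite tnthS; exact: h.
Qed.

(** Each generator of the sigma-algebra of tuples constrains one coordinate, so
it is a box whose other sides are the whole space. *)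
Lemma measurable_tuple_box d (T : measurableType d) n :
  @measurable _ (n.-tuple T) =
  <<s [set X | exists2 A : 'I_n -> set T,
                 (forall i, measurable (A i)) & X = box A] >>.
Proof.
apply/seteqP; split; last first.
  apply: smallest_sub; first exact: sigma_algebra_measurable.
  by move=> _ [A mA ->]; exact: measurable_box.
apply: smallest_sub; first exact: smallest_sigma_algebra.
move=> X; rewrite -bigcup_seq => -[i _ [B mB <-]].
apply: sub_sigma_algebra; exists (fun j => if j == i then B else setT).
  by move=> j; case: ifP.
apply/seteqP; split=> x /=.
  by case=> _ Bx j; case: eqVneq => [->|].
by move=> /(_ i); rewrite eqxx.
Qed.

(** Boxes form a generating system closed under intersection, so that two
probabilities agreeing on them are equal. *)
Lemma power_measure_unique d (T : measurableType d) (R : realType)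
    (mu : probability T R) n (m : probability (n.-tuple T) R) :
  (forall A : 'I_n -> set T, (forall i, measurable (A i)) ->
    m (box A) = (\prod_(i < n) mu (A i))%E) ->
  forall X, measurable X -> m X = power_measure mu n X.
Proof.
move=> mE; apply: (measure_unique _ (fun=> setT) (measurable_tuple_box T n)).
- move=> _ _ [A mA ->] [B mB ->]; exists (fun i => A i `&` B i).
    by move=> i; exact: measurableI.
  apply/seteqP; split=> x /=; first by case=> hA hB i; split.
  by move=> h; split=> i; case: (h i).
- by move=> _; exists (fun=> setT) => //; apply/seteqP; split.
- by rewrite bigcup_const//; exists 0%N.
- by move=> _ [A mA ->];
  exact: etrans (mE A mA) (esym (power_measure_box _ mA)).
- by move=> _; rewrite [X in (X < _)%E]probability_setT ltry.
Qed.

(** * Sampling along an injection *)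

Definition select (T : Type) (n N : nat) (psi : 'I_n -> 'I_N) (x : N.-tuple T) :
  n.-tuple T := [tuple tnth x (psi i) | i < n].

Section Select.
Context d (T : measurableType d) (n N : nat) (psi : 'I_n -> 'I_N).

Lemma measurable_select : measurable_fun setT (@select T n N psi).
Proof.
apply/measurable_fun_tnthP => i.
rewrite (_ : _ \o _ = fun x => tnth x (psi i)); first exact: measurable_tnth.
by apply/funext => x /=; rewrite tnth_mktuple.
Qed.

HB.instance Definition _ :=
  isMeasurableFun.Build _ _ _ _ (@select T n N psi) measurable_select.

Context (R : realType) (mu : probability T R).
Hypothesis psi_inj : injective psi.

(** Distinct coordinates of an i.i.d. sample are again an i.i.d. sample: the
image under [select psi] of the N-fold product measure is the n-fold one,
because a box pulls back to the box with side [A i] in coordinate [psi i] and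
the whole space in the coordinates outside the range of [psi]. *)
Lemma ge0_integral_select (f : n.-tuple T -> \bar R) :
    measurable_fun setT f -> (forall y, 0 <= f y)%E ->
  (\int[power_measure mu N]_x f (select psi x) =
   \int[power_measure mu n]_y f y)%E.
Proof.
move=> mf f0.
rewrite -(ge0_integral_distribution (P := power_measure mu N) (select psi))//.
apply: eq_measure_integral => X mX _; apply: power_measure_unique => // A mA.
pose B j := if [pick i | psi i == j] is Some i then A i else setT.
have Bpsi i : B (psi i) = A i.
  rewrite /B; case: pickP => [k /eqP /psi_inj ->//|/(_ i)].
  by rewrite eqxx.
have mB j : measurable (B j) by rewrite /B; case: pickP.
transitivity (power_measure mu N (box B)).
  rewrite /= /distribution /pushforward; congr (_ _).
  apply/seteqP; split=> x /= h.
    move=> j; rewrite /B; case: pickP => // i /eqP <-.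
    by have := h i; rewrite tnth_mktuple.
  by move=> i; rewrite tnth_mktuple -Bpsi; exact: h.
rewrite power_measure_box// (bigID (fun j => j \in codom psi)) /=.
rewrite [X in (_ * X)%E]big1 ?mule1; last first.
  move=> j jN; rewrite /B; case: pickP => [i /eqP ij|_].
    by move: jN; rewrite -ij codom_f.
  exact: probability_setT.
rewrite -big_filter.
rewrite (perm_big (map psi (index_enum 'I_n))).
  by rewrite big_map; apply: eq_bigr => i _; rewrite Bpsi.
apply: uniq_perm; first by rewrite filter_uniq// index_enum_uniq.
  by rewrite map_inj_uniq// index_enum_uniq.
move=> j; rewrite mem_filter mem_index_enum andbT.
apply/codomP/mapP => [[i ->]|[i _ ->]]; exists i => //.
by rewrite mem_index_enum.
Qed.

End Select.

(** The probability that [phi] is a homomorphism when the arcs are independent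
and [e] is present with probability [w e], provided [phi] is injective. *)
Definition weight (R : realType) (D : digraph) (V : Type) (w : V * V -> R)
    (phi : D -> V) : R :=
  \prod_(e : D * D | Defs.arc e.1 e.2) w (phi e.1, phi e.2).

Lemma weight_itv (R : realType) (D : digraph) (V : Type) (w : V * V -> R)
    (phi : D -> V) :
  (forall e, 0 <= w e <= 1) -> 0 <= weight w phi <= 1.
Proof.
move=> w01; rewrite /weight; apply/andP; split.
  by apply: prodr_ge0 => e _; case/andP: (w01 (phi e.1, phi e.2)).
by apply: prodr_ile1 => e _; exact: w01.
Qed.

(** The arc probabilities that the kernel [h] assigns to the sample [x]. *)
Definition pullback (T : Type) (R : realType) (N : nat) (h : T * T -> R)
    (x : N.-tuple T) (e : 'I_N * 'I_N) : R := h (tnth x e.1, tnth x e.2).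

Lemma measurable_weight d (T : measurableType d) (R : realType) (D : digraph)
    (h : T * T -> R) (N : nat) (phi : D -> 'I_N) :
  measurable_fun setT h ->
  measurable_fun setT (fun x => weight (pullback h x) phi).
Proof.
move=> mh; rewrite /weight.
under eq_fun do rewrite big_mkcond.
apply: measurable_prod => e _; case: (Defs.arc _ _); last exact: measurable_cst.
apply: (measurableT_comp mh).
by apply: measurable_fun_pair; exact: measurable_tnth.
Qed.

Section Sampling.
Context d (T : measurableType d) (R : realType) (mu : probability T R).
Variable h : T * T -> R.
Hypothesis h01 : kernel01 h.

Lemma pullback_itv N (x : N.-tuple T) e : 0 <= pullback h x e <= 1.
Proof. exact: h01.2. Qed.

Lemma integral_weight (D : digraph) N (phi : D -> 'I_N) :
  injective phi ->
  (\int[power_measure mu N]_x (weight (pullback h x) phi)%:E = U mu D h)%E.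
Proof.
move=> phi_inj.
rewrite /U -(ge0_integral_select (psi := phi \o enum_val) mu); last 3 first.
- by apply: inj_comp => //; exact: enum_val_inj.
- apply/measurable_EFinP.
  exact: (@measurable_weight _ _ _ _ _ _ enum_rank h01.1).
- move=> y; rewrite lee_fin.
  by case/andP: (@weight_itv _ D _ _ enum_rank (@pullback_itv _ y)).
apply: eq_integral => x _; congr (_%:E); apply: eq_bigr => e _.
by rewrite !tnth_mktuple /= !enum_rankK.
Qed.

Lemma U_itv (D : digraph) : (0 <= U mu D h <= 1)%E.
Proof.
have w01 y := @weight_itv _ D _ _ enum_rank (@pullback_itv _ y).
apply/andP; split.
  by apply: integral_ge0 => y _; rewrite lee_fin; case/andP: (w01 y).
have : (U mu D h <= \int[power_measure mu #|D|]_x 1)%E.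
  apply: ge0_le_integral => //.
  - by move=> y _; rewrite lee_fin; case/andP: (w01 y).
  - apply/measurable_EFinP.
    exact: (@measurable_weight _ _ _ _ _ _ enum_rank h01.1).
  - by move=> y _; rewrite lee_fin; case/andP: (w01 y).
by rewrite integral_cst// [X in (_ * X)%E]probability_setT mule1.
Qed.

(** [N ^_ k] is the number of injections from k points to N points, and by
[integral_weight] they all have the same integral. *)
Lemma integral_sum_weight (D : digraph) N :
  (\int[power_measure mu N]_x
      (\sum_(phi : {ffun D -> 'I_N} | injectiveb phi)
          weight (pullback h x) phi)%:E = (N ^_ #|D|)%:R%:E * U mu D h)%E.
Proof.
under eq_integral do rewrite -sumEFin -big_filter.
rewrite ge0_integral_sum//; last 2 first.
- by move=> phi; apply/measurable_EFinP; exact: measurable_weight h01.1.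
- move=> phi x _; rewrite lee_fin.
  by case/andP: (weight_itv phi (pullback_itv x)).
rewrite big_filter (eq_bigr (fun=> U mu D h)); last first.
  by move=> phi /fintype.injectiveP; exact: integral_weight.
have/andP[U0 U1] := U_itv D.
have Ufin : U mu D h \is a fin_num.
  by rewrite fin_real// (lt_le_trans _ U0)//= (le_lt_trans U1)// ltry.
rewrite -(fineK Ufin) sumEFin -EFinM sumr_const; congr (_%:E).
rewrite -[LHS]mulr_natl; congr (_%:R * _).
by rewrite -[N in RHS]card_ord -card_inj_ffuns cardsE.
Qed.

End Sampling.

(** * Random digraphs with prescribed arc probabilities *)

Lemma hom_sumE (D H : digraph) :
  Defs.hom D H = (\sum_(phi : {ffun D -> H}) is_hom phi)%N.
Proof.
rewrite /Defs.hom -sum1_card big_mkcond; apply: eq_bigr => phi _.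
rewrite (_ : (phi \in _) = is_hom phi); first by case: ifP.
by apply/idP/idP => [/set_mem|/mem_set].
Qed.

(** The pairs on the diagonal are dropped here and not from [A], so that arc
sets may range over all of [{set V * V}] and the product formula below runs over
a full cartesian product. *)
Definition digraph_of (V : finType) (A : {set V * V}) : digraph :=
  @Digraph V (fun i j => (i != j) && ((i, j) \in A))
    (fun i => introF andP (fun h => elimN eqP h.1 erefl)).

Section RandomDigraph.
Context (R : realType) (V : finType) (w : V * V -> R).
Hypothesis w01 : forall e, 0 <= w e <= 1.

Definition arcs_prob (A : {set V * V}) : R :=
  \prod_e (if e \in A then w e else 1 - w e).

Lemma arcs_prob_ge0 A : 0 <= arcs_prob A.
Proof.
apply: prodr_ge0 => e _; have/andP[w0 w1] := w01 e.
by case: ifP => // _; rewrite subr_ge0.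
Qed.

(** The probability that all arcs of [S] are present: expand the product of
[w e + (1 - w e)] with the second summand deleted for [e] in [S]; the surviving
terms are those of the arc sets containing [S]. *)
Lemma sum_arcs_prob_sup (S : {set V * V}) :
  \sum_A arcs_prob A * (S \subset A)%:R = \prod_(e in S) w e.
Proof.
transitivity (\prod_e (w e + (if e \in S then 0 else 1 - w e))); last first.
  rewrite [RHS]big_mkcond; apply: eq_bigr => e _.
  by case: ifP => _; rewrite ?addr0 // addrCA subrr addr0.
rewrite bigA_distr; apply: eq_bigr => A _.
case: (boolP (S \subset A)) => [/fintype.subsetP SA|/subsetPn[e eS eA]].
  rewrite mulr1; apply: eq_bigr => e _; case: ifPn => // eA.
  by rewrite ifN//; apply: contra eA; exact: SA.
by rewrite mulr0 (bigD1 e)//= (negbTE eA) eS mul0r.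
Qed.

Lemma sum_arcs_prob : \sum_A arcs_prob A = 1.
Proof.
have <- : \prod_(e in finset.set0) w e = 1 by rewrite big_set0.
rewrite -sum_arcs_prob_sup; apply: eq_bigr => A _.
by rewrite finset.sub0set mulr1.
Qed.

(** By injectivity distinct arcs of [D] have distinct images, so that their
probabilities multiply; and no arc is mapped to the diagonal, where [digraph_of]
has no arcs, so that [phi] is a homomorphism exactly when the image of the arc
set lies in [A]. *)
Lemma prob_is_hom (D : digraph) (phi : D -> V) : injective phi ->
  \sum_A arcs_prob A * (is_hom (phi : D -> digraph_of A))%:R = weight w phi.
Proof.
move=> phi_inj; pose f (e : D * D) := (phi e.1, phi e.2).
have f_inj : injective f by move=> [a b] [a' b'] [/phi_inj -> /phi_inj ->].
rewrite /weight -(big_imset (h := f) w) => [|e e' _ _]; last exact: f_inj.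
rewrite -sum_arcs_prob_sup; apply: eq_bigr => A _.
congr (_ * (nat_of_bool _)%:R).
apply/'forall_forallP/fintype.subsetP => [homA _ /imsetP[[u v] uv ->]|subA u v].
  by have /implyP/(_ uv)/andP[] := homA u v.
apply/implyP => uv /=; rewrite (inj_eq phi_inj).
rewrite (contraTneq _ uv) => [|->]; last by rewrite arc_irrefl.
by apply: subA; apply/imsetP; exists (u, v).
Qed.

Lemma expected_homE (D : digraph) :
  \sum_A arcs_prob A * (Defs.hom D (digraph_of A))%:R =
  \sum_(phi : {ffun D -> V})
     \sum_A arcs_prob A * (is_hom (phi : D -> digraph_of A))%:R.
Proof.
rewrite exchange_big; apply: eq_bigr => A _.
by rewrite -mulr_sumr -natr_sum hom_sumE.
Qed.

(** The maps that are not injective are homomorphisms with some probability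
between 0 and 1; the last term is their number. *)
Lemma expected_hom_itv (D : digraph) :
  \sum_(phi : {ffun D -> V} | injectiveb phi) weight w phi <=
  \sum_A arcs_prob A * (Defs.hom D (digraph_of A))%:R <=
  \sum_(phi : {ffun D -> V} | injectiveb phi) weight w phi +
    ((#|V| ^ #|D|)%:R - (#|V| ^_ #|D|)%:R).
Proof.
pose p (phi : {ffun D -> V}) :=
  \sum_A arcs_prob A * (is_hom (phi : D -> digraph_of A))%:R.
have -> : \sum_A arcs_prob A * (Defs.hom D (digraph_of A))%:R =
    \sum_(phi : {ffun D -> V} | injectiveb phi) weight w phi +
    \sum_(phi : {ffun D -> V} | ~~ injectiveb phi) p phi.
  rewrite expected_homE (bigID (fun phi : {ffun D -> V} => injectiveb phi)) /=.
  congr (_ + _); apply: eq_bigr => phi /fintype.injectiveP.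
  exact: prob_is_hom.
rewrite lerDl lerD2l; apply/andP; split.
  by do 2!apply: sumr_ge0 => ? _; rewrite mulr_ge0 ?arcs_prob_ge0.
apply: (@le_trans _ _ (\sum_(phi : {ffun D -> V} | ~~ injectiveb phi) 1)).
  apply: ler_sum => phi _; rewrite -sum_arcs_prob; apply: ler_sum => A _.
  by rewrite ler_piMr ?arcs_prob_ge0// lern1 leq_b1.
rewrite sumr_const lerBrDr -natrD ler_nat.
rewrite -card_inj_ffuns -card_ffun.
rewrite -[leqRHS](cardC (fun phi : {ffun D -> V} => injectiveb phi)).
by rewrite cardsE addnC.
Qed.

End RandomDigraph.

(** The inequality between homomorphism densities, averaged over the random
digraph and expressed by the injective maps alone: those that are not injective
are dropped on the left and counted with probability 1 on the right. *)
Lemma sum_weight_le (R : realType) (D F : digraph) (V : finType)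
    (w : V * V -> R) :
  (forall e, 0 <= w e <= 1) -> (0 < #|V|)%N ->
  (forall H : digraph, (0 < #|H|)%N -> hom_density F H <= hom_density D H) ->
  (#|V| ^ #|F|)%:R^-1 *
    (\sum_(phi : {ffun F -> V} | injectiveb phi) weight w phi) <=
  (#|V| ^ #|D|)%:R^-1 *
    (\sum_(phi : {ffun D -> V} | injectiveb phi) weight w phi) +
    (1 - (#|V| ^ #|D|)%:R^-1 * (#|V| ^_ #|D|)%:R).
Proof.
move=> w01 V0 homFD.
have NX0 n : (#|V| ^ n)%:R != 0 :> R by rewrite pnatr_eq0 -lt0n expn_gt0 V0.
rewrite -[X in _ + (X - _)](mulVf (NX0 #|D|)) -mulrBr -mulrDr.
have/andP[+ _] := expected_hom_itv w01 F.
have/andP[_] := expected_hom_itv w01 D.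
rewrite -(ler_pM2l (x := (#|V| ^ #|D|)%:R^-1)) ?invr_gt0 ?lt0r ?NX0 ?ler0n//.
move=> leD; rewrite -(ler_pM2l (x := (#|V| ^ #|F|)%:R^-1))
  ?invr_gt0 ?lt0r ?NX0 ?ler0n//.
move=> /le_trans; apply; apply: le_trans leD.
rewrite !mulr_sumr; apply: ler_sum => A _.
rewrite mulrCA [leRHS]mulrCA ler_wpM2l ?arcs_prob_ge0//.
have := homFD (digraph_of A) V0; rewrite /hom_density -(ler_rat R).
by rewrite !rmorph_div/= ?unitfE ?pnatr_eq0 -?lt0n ?expn_gt0 ?V0//
  !ratr_nat mulrC [leRHS]mulrC.
Qed.

Lemma ffact_le_expn (n k : nat) : (n ^_ k <= n ^ k)%N.
Proof.
by elim: k => // k IH; rewrite ffactnSr expnSr leq_mul// leq_subr.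
Qed.

(** At most the proportion [k ^ 2 / N] of the maps from k points to N points
fail to be injective.  Passing from k to k + 1 multiplies the ratio, which is at
most 1, by at least [1 - k / N]; so it loses at most [k / N], and
[k ^ 2 + k <= (k + 1) ^ 2]. *)
Lemma ffact_ratio_ge (R : realType) (N k : nat) : (0 < N)%N ->
  1 - (k ^ 2)%:R / N%:R <= (N ^ k)%:R^-1 * (N ^_ k)%:R :> R.
Proof.
move=> N0; have N0R : 0 < N%:R :> R by rewrite ltr0n.
elim: k => [|k IH]; first by rewrite mul0r subr0 invr1 mul1r.
set r : R := (N ^ k)%:R^-1 * (N ^_ k)%:R in IH.
have r0 : 0 <= r by rewrite mulr_ge0 ?invr_ge0.
have r1 : r <= 1.
  by rewrite ler_pdivrMl ?ltr0n ?expn_gt0 ?N0// mulr1 ler_nat ffact_le_expn.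
have -> : (N ^ k.+1)%:R^-1 * (N ^_ k.+1)%:R = r * ((N - k)%:R / N%:R) :> R.
  rewrite expnSr ffactnSr !natrM invfM /r; ring.
have Nk : 1 - k%:R / N%:R <= (N - k)%:R / N%:R :> R.
  rewrite -[X in X - _ <= _](divff (lt0r_neq0 N0R)) -mulrBl ler_pM2r ?invr_gt0//.
  by rewrite lerBlDr -natrD ler_nat addnC -leq_subLR.
apply: le_trans (ler_wpM2l r0 Nk).
have : 0 <= k%:R / N%:R :> R by rewrite divr_ge0.
have -> : (k.+1 ^ 2)%:R / N%:R =
    (k ^ 2)%:R / N%:R + 2 * (k%:R / N%:R) + N%:R^-1 :> R.
  by rewrite !natrX -natr1; ring.
have : 0 < N%:R^-1 :> R by rewrite invr_gt0.
nra.
Qed.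

(** * From digraphs to kernels *)

Lemma U_le_of_hom_density_le (R : realType) (D F : digraph)
    d (T : measurableType d) (mu : probability T R) (h : T * T -> R) :
  (forall H : digraph, (0 < #|H|)%N -> hom_density F H <= hom_density D H) ->
  kernel01 h -> (U mu F h <= U mu D h)%E.
Proof.
move=> homFD h01.
have Ufin K : exists2 u, U mu K h = u%:E & 0 <= u <= 1.
  have := U_itv mu h01 K; case: (U mu K h) => [u||].
  - by rewrite !lee_fin; exists u.
  - by case/andP.
  - by case/andP.
have [uF UF /andP[uF0 uF1]] := Ufin F; have [uD UD /andP[uD0 uD1]] := Ufin D.
have bound N : (0 < N)%N ->
    uF <= uD + ((#|F| ^ 2)%:R + (#|D| ^ 2)%:R) / N%:R.
  move=> N0; pose r (k : nat) : R := (N ^ k)%:R^-1 * (N ^_ k)%:R.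
  (* [S K x] is the expected number of injective homomorphisms, given [x]. *)
  pose S K x : R := \sum_(phi : {ffun vertex K -> 'I_N} | injectiveb phi)
    weight (pullback h x) phi.
  have S0 K x : 0 <= S K x.
    apply: sumr_ge0 => phi _.
    by case/andP: (weight_itv phi (pullback_itv h01 x)).
  have mS K : measurable_fun setT (EFin \o S K).
    apply/measurable_EFinP; rewrite /S.
    under eq_fun do rewrite -big_filter.
    by apply: measurable_sum => phi; exact: measurable_weight h01.1.
  have intS K u : U mu K h = u%:E ->
      (\int[power_measure mu N]_x ((N ^ #|K|)%:R^-1 * S K x)%:E =
       (r #|K| * u)%:E)%E.
    move=> UK; under eq_integral do rewrite EFinM.
    rewrite (ge0_integralZl_EFin _ measurableT _ (mS K))//; last first.
      by move=> x _; rewrite lee_fin.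
    by rewrite integral_sum_weight// UK -!EFinM mulrA.
  have r1 K : 0 <= r K <= 1.
    rewrite mulr_ge0 ?invr_ge0//= ler_pdivrMl ?ltr0n ?expn_gt0 ?N0//.
    by rewrite mulr1 ler_nat ffact_le_expn.
  have : r #|F| * uF <= r #|D| * uD + (1 - r #|D|).
    rewrite -lee_fin EFinD -(intS F)// -(intS D)//.
    have c0 : 0 <= 1 - r #|D| by rewrite subr_ge0; case/andP: (r1 #|D|).
    have intc :
        (\int[power_measure mu N]_x (1 - r #|D|)%:E = (1 - r #|D|)%:E)%E.
      by rewrite integral_cst// [X in (_ * X)%E]probability_setT mule1.
    have T0 (K : digraph) x : (0 <= ((N ^ #|K|)%:R^-1 * S K x)%:E)%E.
      by rewrite lee_fin mulr_ge0.
    have mT (K : digraph) :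
        measurable_fun setT (fun x => ((N ^ #|K|)%:R^-1 * S K x)%:E).
      by under eq_fun do rewrite EFinM; exact: measurable_funeM (mS K).
    rewrite -[X in (_ + X)%E]intc -ge0_integralD//.
    apply: ge0_le_integral => //; first exact: emeasurable_funD.
    move=> x _; rewrite -EFinD lee_fin.
    have := sum_weight_le (pullback_itv h01 x) _ homFD.
    by rewrite card_ord; apply.
  have := ffact_ratio_ge R #|F| N0; have := ffact_ratio_ge R #|D| N0.
  rewrite -/(r _) -/(r _) mulrDl.
  have/andP[rF0 rF1] := r1 #|F|; have/andP[rD0 rD1] := r1 #|D|.
  (* Both ratios [r] are within [k ^ 2 / N] of 1, while [uF] and [uD] lie in
     the unit interval. *)
  set a := _ / _; set b := _ / _; nra.
(* The error term of [bound] tends to 0: take [N] larger than [c / e]. *)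
rewrite UF UD lee_fin; apply/ler_addgt0Pr => e e0.
set c : R := (#|F| ^ 2)%:R + (#|D| ^ 2)%:R in bound.
have c0 : 0 <= c by rewrite addr_ge0.
pose N := (Num.truncn (c / e)).+1.
apply: le_trans (bound N isT) _; rewrite lerD2l ler_pdivrMr ?ltr0n//.
by rewrite mulrC -ler_pdivrMr// ltW// truncnS_gt.
Qed.

(** * From kernels to digraphs *)

(** The law of [a j] for a uniform random [j].  [msum] takes a sequence of
measures, whence the enumeration of [J] with the default [j0], which is never
reached below [#|J|]. *)
Definition unif (J : finType) (j0 : J) d (T : measurableType d) (R : realType)
    (a : J -> T) : set T -> \bar R :=
  mscale (#|J|%:R^-1)%:nng (msum (fun k => \d_(a (nth j0 (enum J) k))) #|J|).

Section Uniform.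
Context (J : finType) (j0 : J) d (T : measurableType d) (R : realType).
Variable a : J -> T.

HB.instance Definition _ := Measure.on (unif j0 R a).

Lemma sum_nth_enum (f : J -> \bar R) :
  (\sum_(k < #|J|) f (nth j0 (enum J) k) = \sum_j f j)%E.
Proof.
rewrite [RHS](reindex_onto (enum_val) enum_rank) => [|j _];
  last exact: enum_rankK.
rewrite [RHS](eq_bigl xpredT) => [|k]; last by rewrite enum_valK eqxx.
by apply: eq_bigr => k _; rewrite (enum_val_nth j0).
Qed.

Lemma unifE (A : set T) : unif j0 R a A = (#|J|%:R^-1 * \sum_j \1_A (a j))%:E.
Proof.
rewrite /unif /mscale /msum /= EFinM; congr (_ * _)%E.
by rewrite -sumEFin -(sum_nth_enum (fun j => (\1_A (a j))%:E)).
Qed.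

Let unif_setT : unif j0 R a setT = 1%E.
Proof.
rewrite unifE; congr (_%:E); under eq_bigr do rewrite indicT.
rewrite sumr_const mulVf// pnatr_eq0 -lt0n; apply/card_gt0P; by exists j0.
Qed.

HB.instance Definition _ := Measure_isProbability.Build _ _ _
  (unif j0 R a) unif_setT.

Lemma ge0_integral_unif (f : T -> R) :
    measurable_fun setT f -> (forall x, 0 <= f x) ->
  (\int[unif j0 R a]_x (f x)%:E = (#|J|%:R^-1 * \sum_j f (a j))%:E)%E.
Proof.
move=> mf f0.
have mf' : measurable_fun setT (EFin \o f) by exact/measurable_EFinP.
have f0' x : (0 <= (f x)%:E)%E by rewrite lee_fin.
rewrite [LHS]ge0_integral_mscale// [RHS]EFinM; congr (_ * _)%E.
rewrite [LHS]ge0_integral_measure_sum//.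
rewrite -sumEFin -(sum_nth_enum (fun j => (f (a j))%:E)); apply: eq_bigr => k _.
by rewrite integral_dirac//= diracT mul1e.
Qed.

End Uniform.

Section Steps.
Context (H : digraph) (v0 : H) d (T : measurableType d) (R : realType).
Variable a : H -> T.
Hypothesis a_inj : injective a.
Hypothesis ma : forall v, measurable [set a v].

Definition points (D : digraph) (g : {ffun D -> H}) : #|D|.-tuple T :=
  [tuple a (g (enum_val i)) | i < #|D|].

(** The independent uniform choice of a vertex of [H] for each vertex of [D] is
the uniform choice of a map; on boxes this is the expansion of a product of
sums. *)
Lemma power_unif (D : digraph) X : measurable X ->
  unif [ffun=> v0] R (@points D) X = power_measure (unif v0 R a) #|D| X.
Proof.
move: X; apply: (power_measure_unique (m := unif [ffun=> v0] R (@points D))).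
move=> A mA; rewrite [LHS]unifE.
transitivity (\prod_(i < #|D|) (#|H|%:R^-1 * \sum_v \1_(A i) (a v) : R)%:E)%E;
  last by apply: eq_bigr => i _; rewrite [RHS]unifE.
rewrite prodEFin; congr (_%:E).
rewrite big_split /= prodr_const card_ord card_ffun natrX exprVn; congr (_ * _).
rewrite (reindex (@enum_rank D)) /=; last first.
  by exists enum_val => ? _; rewrite ?enum_valK ?enum_rankK.
rewrite bigA_distr_bigA; apply: eq_bigr => g _.
rewrite indicE; case: (boolP (_ \in _)) => [/set_mem gA|gA].
  rewrite big1// => u _; rewrite indicE mem_set//.
  by have := gA (enum_rank u); rewrite tnth_mktuple enum_rankK.
suff [u Au] : exists u, ~ A (enum_rank u) (a (g u)).
  by rewrite (bigD1 u)//= indicE memNset// mul0r.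
apply/existsNP => Ag; move/negP: gA; apply; apply/mem_set => i.
by rewrite tnth_mktuple -{1}(enum_valK i); exact: Ag.
Qed.

Definition arc_kernel : T * T -> R :=
  \1_[set z | exists2 e : H * H, Defs.arc e.1 e.2 & z = (a e.1, a e.2)].

Lemma arc_kernelE u v : arc_kernel (a u, a v) = (Defs.arc u v)%:R.
Proof.
rewrite /arc_kernel indicE; congr (nat_of_bool _)%:R.
apply/idP/idP => [/set_mem[[u' v'] /= + [/a_inj -> /a_inj ->]]//|uv].
by apply/mem_set; exists (u, v).
Qed.

Lemma kernel01_arc_kernel : kernel01 arc_kernel.
Proof.
split=> [|z]; last by rewrite /arc_kernel indicE lern1 leq_b1 ler0n.
apply: measurable_indic.
rewrite (_ : mkset _ = \bigcup_(e in [set e : H * H | Defs.arc e.1 e.2])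
    ([set a e.1] `*` [set a e.2])).
  apply: fin_bigcup_measurable => [|e _]; first exact: finite_finset.
  exact: measurableX.
by apply/seteqP; split=> [z [e ae ->]|[x y] [e ae [/= -> ->]]]; exists e.
Qed.

(** For points a(g(u)) the product of the values of the kernel over the arcs of
[D] is 1 or 0 according to whether [g] is a homomorphism. *)
Lemma U_arc_kernel (D : digraph) :
  U (unif v0 R a) D arc_kernel = (ratr (hom_density D H))%:E.
Proof.
have k01 := kernel01_arc_kernel.
rewrite /U (eq_measure_integral (unif [ffun=> v0] R (@points D))); last first.
  by move=> X mX _; exact: (esym (power_unif _)).
rewrite (@ge0_integral_unif _ _ _ _ _ _
  (fun x => weight (pullback arc_kernel x) enum_rank)); last 2 first.
- exact: measurable_weight k01.1.
- by move=> x; case/andP: (weight_itv (D := D) enum_rank (pullback_itv k01 x)).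
congr (_%:E); rewrite /hom_density rmorph_div/= ?unitfE ?pnatr_eq0; last first.
  by rewrite -lt0n expn_gt0 (_ : (0 < #|H|)%N)//; apply/card_gt0P; exists v0.
rewrite !ratr_nat mulrC card_ffun hom_sumE natr_sum; congr (_ / _).
apply: eq_bigr => g _; rewrite /weight.
under eq_bigr do rewrite /pullback !tnth_mktuple !enum_rankK arc_kernelE.
case: (boolP (is_hom g)) => [/'forall_forallP hg|].
  rewrite big1// => -[u v] /= uv.
  by rewrite (implyP (hg u v) uv).
rewrite negb_forall => /existsP[u]; rewrite negb_forall => /existsP[v].
rewrite negb_imply => /andP[uv guv].
by rewrite (bigD1 (u, v))//= (negbTE guv) mul0r.
Qed.

End Steps.

(** Open intervals generate the Borel sets of the line. *)
Lemma standard_borel_realType (R : realType) : standard_borel R R.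
Proof.
exists R; split.
  split; first exact: (@norm_hausdorff R R^o).
  exists (range ratr); last exact: dense_rat.
  apply: sub_countable (countableP [set: rat]); exact: card_image_le.
exists id; first by exists id.
move=> A; rewrite image_id; split; last first.
  apply: smallest_sub; first exact: sigma_algebra_measurable.
  exact: open_measurable.
change ((@ocitv R).-sigma.-measurable A -> <<s open >> A).
rewrite RGenOpens.measurableE; apply: sub_sigma_algebra2.
by move=> _ [x [y ->]]; exact: interval_open.
Qed.

(** * The equivalence *)

Theorem propositionB7 (R : realType) (D F : digraph) :
  (forall (d : measure_display) (T : measurableType d) (mu : probability T R)
      (h : T * T -> R),
    standard_borel R T -> kernel01 h -> (U mu F h <= U mu D h)%E) <->
  (forall H : digraph, (0 < #|H|)%N -> hom_density F H <= hom_density D H).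
Proof.
split=> [UFD H /card_gt0P[v0 _]|homFD d T mu h _ h01]; last first.
  exact: U_le_of_hom_density_le.
pose a (v : H) : R := (enum_rank v)%:R.
have a_inj : injective a.
  by move=> u v /eqP; rewrite eqr_nat => /eqP/val_inj/enum_rank_inj.
have ma v : measurable [set a v] by exact: measurable_set1.
have := UFD _ _ (unif v0 R a) _ (standard_borel_realType R)
  (kernel01_arc_kernel R ma).
by rewrite !U_arc_kernel// lee_fin ler_rat.
Qed.
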